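(* Let $A$ be a (real or complex) Banach algebra. Then every component of $L(A)$ is either unbounded or a singleton.
   Context: Algebras are real or complex associative algebras, not assumed unital. $L(A) := \{ a \in A : axay = axy \ \text{for all } x,y \in A\}$ is the set of endomorphic left elements of $A$. Components are connected components, with $L(A)$ carrying the relative norm topology. *)

(* Defs.v *)
From HB Require Import structures.
From mathcomp Require Import all_boot all_order all_algebra.
From mathcomp Require Import complex.
From mathcomp Require Import all_classical all_reals all_analysis.
Set Implicit Arguments.
Unset Strict Implicit.
Unset Printing Implicit Defensive.

Import Order.TTheory GRing.Theory Num.Theory.
Import numFieldNormedType.Exports.

Local Open Scope classical_set_scope.
Local Open Scope ring_scope.

(* The ring and algebra structures of ssralg all carry a multiplicative unit,
   so the product of a not necessarily unital algebra is a separate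
   operation. *)
HB.mixin Record CompleteNormedModule_isBanachAlgebra (K : numFieldType) A
    of CompleteNormedModule K A := {
  bmul : A -> A -> A;
  bmulA : associative bmul;
  bmulDl : left_distributive bmul +%R;
  bmulDr : right_distributive bmul +%R;
  bmulZl : forall (k : K) (x y : A), bmul (k *: x) y = k *: bmul x y;
  bmulZr : forall (k : K) (x y : A), bmul x (k *: y) = k *: bmul x y;
  ler_norm_bmul : forall x y : A, `|bmul x y| <= `|x| * `|y|
}.

#[short(type="banachAlgebraType")]
HB.structure Definition BanachAlgebra (K : numFieldType) :=
  { A of CompleteNormedModule_isBanachAlgebra K A & CompleteNormedModule K A }.

Declare Scope banach_scope.
Delimit Scope banach_scope with B.
Notation "x ** y" := (bmul x y)
  (at level 40, left associativity) : banach_scope.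
Local Open Scope banach_scope.

Definition endomorphic_left (K : numFieldType) (A : banachAlgebraType K) :
    set A :=
  [set a | forall x y : A, a ** x ** a ** y = a ** x ** y].
Arguments endomorphic_left {K} A.

(* Connectedness of a subset of A, as used in connected_component, is
   connectedness in the subspace topology. *)
Definition is_component (T : topologicalType) (X C : set T) : Prop :=
  exists2 a, X a & C = connected_component X a.

(* Main.v *)
Require Import Defs.
From HB Require Import structures.
From mathcomp Require Import all_boot all_order all_algebra.
From mathcomp Require Import complex.
From mathcomp Require Import all_classical all_reals all_analysis.
Import Order.TTheory GRing.Theory Num.Theory.
Import numFieldNormedType.Exports.
Local Open Scope classical_set_scope.
Local Open Scope ring_scope.

(** Multiplication is written by juxtaposition.  Membership of [a] in [L(A)]
    says that, in the word [a x a y], the second [a] may be erased.  Erasing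
    such letters ([endomorphic_left_erase]) shows that each of the vectors
        [n = a a - a],   [n = a z - a z a],   [n = z a - a z a]
    is the direction of a line [a + k n] contained in [L(A)]
    ([line_endomorphic_left]).  A line is connected, so it lies in the component
    of [a]; if that component is bounded, the line must degenerate, that is,
    [n = 0] ([bounded_line_direction0]).  Hence every point of a bounded
    component is an idempotent that commutes with all of [A].

    Two commuting idempotents [a] and [b] satisfy [(a - b)^3 = a - b], so they
    are equal or at distance at least 1 ([commuting_idempotents_isolated]).  A
    bounded component is therefore discrete as well as connected, and a
    discrete connected set is a singleton.

    Lines are connected because the scalar field is; this is the one property
    of the field that enters, so [bounded_component_set1] covers real and
    complex algebras alike. *)

Section BanachAlgebraTheory.
Context {K : numFieldType} {A : banachAlgebraType K}.
Local Open Scope banach_scope.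
Implicit Types (a b n x y z : A) (k : K).

Lemma bmulNl x y : (- x) ** y = - (x ** y).
Proof. by rewrite -scaleN1r bmulZl scaleN1r. Qed.

Lemma bmulNr x y : x ** (- y) = - (x ** y).
Proof. by rewrite -scaleN1r bmulZr scaleN1r. Qed.

Lemma bmulBl x y z : (x - y) ** z = x ** z - y ** z.
Proof. by rewrite bmulDl bmulNl. Qed.

Lemma bmulBr x y z : x ** (y - z) = x ** y - x ** z.
Proof. by rewrite bmulDr bmulNr. Qed.

(** Expanding [(a + k n) x (a + k n) y] gives [a x a y = a x y], two terms
    that vanish, and [k n x a y = k n x y]. *)
Lemma line_endomorphic_left a n k :
    endomorphic_left A a ->
    (forall x y, a ** x ** n ** y = 0) ->
    (forall x y, n ** x ** n ** y = 0) ->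
    (forall x y, n ** x ** a ** y = n ** x ** y) ->
  endomorphic_left A (a + k *: n).
Proof.
move=> La axn nxn nxa x y /=.
rewrite !(bmulDl, bmulDr, bmulZl, bmulZr).
by rewrite axn nxn nxa La !scaler0 !addr0.
Qed.

(** A terminating set of rewriting rules on right-associated words.  The second
    rule is the first one for the product [x z], which right-association
    hides; the words met below have at most two letters between consecutive
    [a]'s. *)
Lemma endomorphic_left_erase a :
    endomorphic_left A a ->
  (forall x y, a ** (x ** (a ** y)) = a ** (x ** y)) *
  (forall x z y, a ** (x ** (z ** (a ** y))) = a ** (x ** (z ** y))).
Proof.
move=> La; split=> [x y|x z y]; first by have := La x y; rewrite -!bmulA.
by have := La (x ** z) y; rewrite -!bmulA.
Qed.

Lemma line_idempotent a k :
  endomorphic_left A a -> endomorphic_left A (a + k *: (a ** a - a)).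
Proof.
move=> La; apply: line_endomorphic_left => // x y;
by rewrite !(bmulBl, bmulBr) -!bmulA !(endomorphic_left_erase _ La) ?subrr.
Qed.

Lemma line_commute_left a z k :
  endomorphic_left A a -> endomorphic_left A (a + k *: (a ** z - a ** z ** a)).
Proof.
move=> La; apply: line_endomorphic_left => // x y;
by rewrite !(bmulBl, bmulBr) -!bmulA !(endomorphic_left_erase _ La) ?subrr.
Qed.

Lemma line_commute_right a z k :
  endomorphic_left A a -> endomorphic_left A (a + k *: (z ** a - a ** z ** a)).
Proof.
move=> La; apply: line_endomorphic_left => // x y;
by rewrite !(bmulBl, bmulBr) -!bmulA !(endomorphic_left_erase _ La) ?subrr.
Qed.

(** For commuting idempotents [d = a - b] satisfies [d^3 = d], hence
    [`|d| <= `|d|^3]. *)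
Lemma commuting_idempotents_isolated a b :
    a ** a = a -> b ** b = b -> a ** b = b ** a ->
  `|a - b| < 1 -> a = b.
Proof.
move=> aa bb ab dlt1; apply/eqP; rewrite -subr_eq0 -normr_eq0.
have d3 : (a - b) ** (a - b) ** (a - b) = a - b.
  have ad : a ** (a - b) = a - a ** b by rewrite bmulBr aa.
  have bd : b ** (a - b) = a ** b - b by rewrite bmulBr bb ab.
  have abd : a ** b ** (a - b) = 0.
    by rewrite -bmulA bd bmulBr bmulA aa subrr.
  rewrite [(a - b) ** (a - b)]bmulBl ad bd 3!bmulBl ad bd abd.
  by rewrite subr0 sub0r opprK addrA subrK.
have le_d : `|a - b| <= `|a - b| * `|a - b| * `|a - b|.
  rewrite -{1}d3 (le_trans (ler_norm_bmul _ _)) // ler_wpM2r //.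
  exact: ler_norm_bmul.
apply: contraTT dlt1 => d0; have d_gt0 : 0 < `|a - b| by rewrite lt_def d0 /=.
have : 1 <= `|a - b| * `|a - b| by rewrite -(ler_pM2r d_gt0) mul1r.
rewrite -expr2 => ge1; apply: contraTN ge1 => lt1.
by rewrite lt_geF // exprn_ilt1.
Qed.

Lemma line_connected_component {V : normedModType K} (X : set V) (a n : V) :
    connected [set: K] -> (forall k, X (a + k *: n)) ->
  forall k, connected_component X a (a + k *: n).
Proof.
move=> cK Xan k; exists (range (fun k => a + k *: n)); last by exists k.
split.
- by exists 0; rewrite // scale0r addr0.
- by move=> _ [j _ <-]; exact: Xan.
- apply: connected_continuous_connected => //.
  apply: continuous_subspaceT => x.
  have ck : (fun k => k *: n) k @[k --> x] --> x *: n by exact: scalel_continuous.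
  exact: (cvgD (cvg_cst a) ck).
Qed.

Lemma bounded_line_direction0 {V : normedModType K} (C : set V) (a n : V) :
  bounded_set C -> (forall k, C (a + k *: n)) -> n = 0.
Proof.
move=> [M [Mreal bC]] line; apply/eqP; apply: contraTT isT => n0.
have n_gt0 : 0 < `|n| by rewrite normr_gt0.
pose B := `|M| + 1.
have B_gt0 : 0 < B by rewrite ltr_wpDl.
have ltMB : M < B by rewrite (le_lt_trans (real_ler_norm Mreal)) // ltrDl.
(* this scalar makes [k n] have norm [B + 1 + `|a|], so that [a + k n] has
   norm at least [B + 1] *)
have := bC B ltMB _ (line ((B + 1 + `|a|) / `|n|)).
rewrite /= addrC => le1.
have := le_trans (lerB_normD _ _) le1.
rewrite normrZ normrM normfV normr_id divfK ?gt_eqF // ger0_norm; last first.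
  by rewrite addr_ge0 // addr_ge0 // ltW.
by rewrite addrK gerDl ler10.
Qed.

Lemma bounded_component_set1 (C : set A) :
    connected [set: K] -> is_component (endomorphic_left A) C ->
  bounded_set C -> exists a, C = [set a].
Proof.
move=> cK [a La CE] bC.
have line b n : C b -> (forall k, endomorphic_left A (b + k *: n)) -> n = 0.
  move=> Cb Lbn; apply: (bounded_line_direction0 _ _ _ bC) => k.
  rewrite CE (same_connected_component (y := b)); last by rewrite -CE.
  exact: line_connected_component.
have CL b : C b -> endomorphic_left A b.
  by rewrite CE; exact: connected_component_sub.
have idem b : C b -> b ** b = b.
  move=> Cb; apply/eqP; rewrite -subr_eq0; apply/eqP; apply: (line _ _ Cb) => k.
  exact/line_idempotent/CL.
have central b z : C b -> b ** z = z ** b.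
  move=> Cb; transitivity (b ** z ** b); apply/eqP.
    rewrite -subr_eq0; apply/eqP; apply: (line _ _ Cb) => k.
    exact/line_commute_left/CL.
  rewrite eq_sym -subr_eq0; apply/eqP; apply: (line _ _ Cb) => k.
  exact/line_commute_right/CL.
have Ca : C a by rewrite CE; exact: connected_component_refl.
exists a; apply/esym.
(* [[set a]] is nonempty, relatively open and relatively closed in [C] *)
have : connected C by rewrite CE; exact: component_connected.
apply.
- by exists a.
- exists (ball a 1); first exact: ball_open.
  rewrite eqEsubset; split=> [_ ->|b [Cb]]; first by split=> //; exact: ballxx.
  rewrite -ball_normE /= => ab; apply/esym.
  by apply: commuting_idempotents_isolated; rewrite ?idem ?(central a).
- exists [set a]; first exact/accessible_closed_set1/hausdorff_accessible/norm_hausdorff.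
  by rewrite eqEsubset; split=> [_ ->|b []].
Qed.

End BanachAlgebraTheory.

Lemma connected_real (R : realType) : connected [set: R].
Proof. by apply/connected_intervalP => x y _ _ z _. Qed.

(** The norm on [complex R] takes its values in [complex R], so the radii are
    complex numbers with zero imaginary part. *)
Lemma continuous_real_complex (R : realType) :
  continuous (real_complex R : R -> (complex R : numFieldType)).
Proof.
move=> t; apply/cvgrPdist_lt => e; rewrite ltcE => /andP[/eqP/= Ime0 Ree_gt0].
near=> u; rewrite -rmorphB normc_def /= expr0n addr0 sqrtr_sqr.
rewrite ltcE /= Ime0 eqxx /=.
by near: u; exact: cvgr_dist_lt.
Unshelve. all: by end_near. Qed.

(** The plane is the union of the real lines through the origin. *)
Lemma connected_complex (R : realType) :
  connected [set: (complex R : numFieldType)].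
Proof.
pose line (z : (complex R : numFieldType)) :=
  range (fun t => real_complex R t * z).
have -> : [set: (complex R : numFieldType)] = \bigcup_(z in setT) line z.
  apply/esym; rewrite -subTset => z _; exists z => //.
  by exists 1; rewrite // rmorph1 mul1r.
apply: bigcup_connected => [|z _].
  by exists 0 => z _; exists 0; rewrite // rmorph0 mul0r.
apply: connected_continuous_connected; first exact: connected_real.
apply: continuous_subspaceT => t.
exact: (cvgMr_tmp (@continuous_real_complex R t)).
Qed.

Theorem theorem5p4 (R : realType) :
  (forall (A : banachAlgebraType R) (C : set A),
     is_component (endomorphic_left A) C ->
     ~ bounded_set C \/ exists a : A, C = [set a]) /\
  (forall (A : banachAlgebraType (complex R)) (C : set A),
     is_component (endomorphic_left A) C ->
     ~ bounded_set C \/ exists a : A, C = [set a]).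
Proof.
split=> A C compC; have [bC|] := pselect (bounded_set C); [right| by left |right| by left].
- by apply: bounded_component_set1 compC bC; exact: connected_real.
- by apply: bounded_component_set1 compC bC; exact: connected_complex.
Qed.
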